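(* Let $N$ be a positive integer and let $\{\pi(i); i=0,1,\dots,N\}$ be a probability distribution on $\{0,1,\dots,N\}$ with $\min_{0\le i\le N}\pi(i)>0$. Let $\gamma(i)=\pi(i)/\pi(i+1)$ for $0\le i\le N-1$, and define $$p_0=\frac{1}{1+\gamma(0)},\qquad p_i=\frac{1}{1+\max(\gamma(i),\gamma(i-1))}\quad(1\le i\le N-1),\qquad p_N=0,$$ $$q_0=0,\qquad q_1=\frac{\gamma(0)}{1+\gamma(0)},\qquad q_i=\frac{\gamma(i-1)}{1+\max(\gamma(i-1),\gamma(i-2))}\quad(2\le i\le N),$$ and $r_i=1-p_i-q_i$ for $0\le i\le N$. Let $P=(P(i,j))_{0\le i,j\le N}$ be the tridiagonal matrix with $P(i,i+1)=p_i$ for $0\le i\le N-1$, $P(i,i-1)=q_i$ for $1\le i\le N$, $P(i,i)=r_i$ for $0\le i\le N$, and all other entries $0$. Then $P$ is an irreducible and monotone stochastic matrix whose stationary distribution is equal to $\{\pi(i); i=0,1,\dots,N\}$.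
   Context: A stochastic matrix $P$ on $\{0,1,\dots,N\}$ is called monotone if its rows are stochastically increasing, i.e. $\sum_{j\ge m}P(i,j)\le\sum_{j\ge m}P(i+1,j)$ for all $0\le i\le N-1$ and all $0\le m\le N$. *)

(* Defs.v *)
From HB Require Import structures.
From mathcomp Require Import all_boot all_order all_algebra.
Set Implicit Arguments.
Unset Strict Implicit.
Unset Printing Implicit Defensive.
Import Order.TTheory GRing.Theory Num.Theory.
Local Open Scope ring_scope.

Definition distribution (R : realFieldType) (n : nat) (mu : 'rV[R]_n) : Prop :=
  (forall i, 0 <= mu 0 i) /\ \sum_i mu 0 i = 1.

Definition stochastic (R : realFieldType) (n : nat) (P : 'M[R]_n) : Prop :=
  (forall i j, 0 <= P i j) /\ (forall i, \sum_j P i j = 1).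

Definition monotone (R : realFieldType) (n : nat) (P : 'M[R]_n) : Prop :=
  forall i i' m : 'I_n, i' = i.+1 :> nat ->
    \sum_(j < n | (m <= j)%N) P i j <= \sum_(j < n | (m <= j)%N) P i' j.

Definition irreducible (R : realFieldType) (n : nat) (P : 'M[R]_n.+1) : Prop :=
  forall i j, exists2 k : nat, (0 < k)%N & 0 < (P ^+ k) i j.

Definition stationary (R : realFieldType) (n : nat) (mu : 'rV[R]_n)
    (P : 'M[R]_n) : Prop :=
  distribution mu /\ mu *m P = mu.

(* Meaningful only for i < N, where inord does not fall back to a default. *)
Definition gamma (R : realFieldType) (N : nat) (pi : 'rV[R]_N.+1) (i : nat) : R :=
  pi 0 (inord i) / pi 0 (inord i.+1).

(* The cases i = 0 and i = N are disjoint only when 0 < N. *)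
Definition up_prob (R : realFieldType) (N : nat) (pi : 'rV[R]_N.+1) (i : nat) : R :=
  if i == 0%N then 1 / (1 + gamma pi 0)
  else if i == N then 0
  else 1 / (1 + Num.max (gamma pi i) (gamma pi i.-1)).

Definition down_prob (R : realFieldType) (N : nat) (pi : 'rV[R]_N.+1) (i : nat) : R :=
  match i with
  | 0 => 0
  | 1 => gamma pi 0 / (1 + gamma pi 0)
  | k.+2 => gamma pi k.+1 / (1 + Num.max (gamma pi k.+1) (gamma pi k))
  end.

Definition hold_prob (R : realFieldType) (N : nat) (pi : 'rV[R]_N.+1) (i : nat) : R :=
  1 - up_prob pi i - down_prob pi i.

Definition transition (R : realFieldType) (N : nat) (pi : 'rV[R]_N.+1) :
    'M[R]_N.+1 :=
  \matrix_(i, j)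
    if j == i.+1 :> nat then up_prob pi i
    else if i == j.+1 :> nat then down_prob pi i
    else if i == j then hold_prob pi i
    else 0.

(* Main.v *)
Require Import Defs.
From HB Require Import structures.
From mathcomp Require Import all_boot all_order all_algebra.
From mathcomp Require Import ring lra zify.
Set Implicit Arguments.
Unset Strict Implicit.
Unset Printing Implicit Defensive.
Import Order.TTheory GRing.Theory Num.Theory.
Local Open Scope ring_scope.

(** Write [g i] for [gamma pi i].  The chain satisfies [q (i+1) = g i * p i], which
is detailed balance, and both [p i] and [p (i+1)] are at most [1 / (1 + g i)].
Hence [p i + q i <= 1], which makes the holding probabilities nonnegative, and
[p i + q (i+1) <= 1], which is monotonicity: two consecutive rows of a
birth-death chain can only be in the wrong order at [m = i+1], where the tails are
[p i] and [1 - q (i+1)].  By reversibility [mu] is invariant iff [mu / pi] is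
harmonic, and a harmonic function of a birth-death chain is constant. *)

Section Irreducibility.
Variables (R : realFieldType) (n : nat) (P : 'M[R]_n.+1).
Hypothesis P_ge0 : forall i j, 0 <= P i j.

Lemma exprmx_ge0 k i j : 0 <= (P ^+ k) i j.
Proof.
elim: k i j => [|k IH] i j; first by rewrite expr0 mxE ler0n.
by rewrite exprS mxE sumr_ge0 // => l _; rewrite mulr_ge0.
Qed.

Let reach i j := exists2 k : nat, (0 < k)%N & 0 < (P ^+ k) i j.

Lemma reach_trans j i l : reach i j -> reach j l -> reach i l.
Proof.
move=> [a a0 Pa] [b b0 Pb]; exists (a + b)%N; first by rewrite addn_gt0 a0.
rewrite exprD mxE (bigD1 j) //= ltr_pwDl ?mulr_gt0 // sumr_ge0 // => k _.
by rewrite mulr_ge0 ?exprmx_ge0.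
Qed.

(** Induction on the distance between two distinct states yields paths in both directions between
    them. *)
Lemma neighbour_irreducible :
    (0 < n)%N -> (forall i j : 'I_n.+1, j = i.+1 :> nat -> 0 < P i j /\ 0 < P j i) ->
  irreducible P.
Proof.
move=> n_gt0 Pnb.
have step i j : 0 < P i j -> reach i j by exists 1%N; rewrite ?expr1.
have dist k (i j : 'I_n.+1) : j = (i + k.+1)%N :> nat -> reach i j /\ reach j i.
  elim: k j => [|k IH] j jE.
    by have [] := Pnb i j; [rewrite jE addn1|split; apply: step].
  have lt_n : (i + k.+1 < n.+1)%N by have := ltn_ord j; lia.
  have [r1 r2] := IH (Ordinal lt_n) erefl.
  have [] := Pnb (Ordinal lt_n) j; first by rewrite jE addnS.
  by move=> /step s1 /step s2; split; apply: reach_trans; eassumption.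
have neq (i j : 'I_n.+1) : i != j :> nat -> reach i j.
  case: ltngtP => // ij _.
    by have [|//] := dist (j - i.+1)%N i j; lia.
  by have [|//] := dist (i - j.+1)%N j i; lia.
(* [P i i] may be 0, so a state returns to itself by a round trip through another state [k], which
   exists because [0 < n]. *)
move=> i j; case: (eqVneq (i : nat) j) => [/ord_inj <-|/neq //].
have [k ik] : exists k : 'I_n.+1, i != k :> nat.
  case: (posnP i) => [->|]; last by rewrite lt0n; exists ord0.
  by exists ord_max; rewrite /= eq_sym -lt0n.
by apply: (@reach_trans k); apply: neq; rewrite // eq_sym.
Qed.

End Irreducibility.

Section BirthDeath.
Variables (R : realFieldType) (N : nat) (pi : 'rV[R]_N.+1).
Hypotheses (N_gt0 : (0 < N)%N) (pi_gt0 : forall i, 0 < pi 0 i).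

Local Notation g := (gamma pi).
Local Notation p := (up_prob pi).
Local Notation q := (down_prob pi).
Local Notation r := (hold_prob pi).
Local Notation T := (transition pi).

(** This covers every natural [i]: out of range, [inord] falls back to some state, and [pi] is
    positive there too. *)
Lemma gamma_gt0 i : 0 < g i.
Proof. by rewrite divr_gt0. Qed.

Lemma up_prob_gt0 i : (i < N)%N -> 0 < p i.
Proof.
move=> iN; rewrite /up_prob (ltn_eqF iN).
by case: eqP => _; rewrite divr_gt0 // addr_gt0 // ?lt_max gamma_gt0.
Qed.

Lemma up_prob_N : p N = 0.
Proof. by rewrite /up_prob eqxx gtn_eqF. Qed.

Lemma up_prob_ge0 i : (i <= N)%N -> 0 <= p i.
Proof.
by rewrite leq_eqVlt => /orP[/eqP->|/up_prob_gt0/ltW //]; rewrite up_prob_N.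
Qed.

Lemma up_prob_le i : (1 + g i) * p i <= 1.
Proof.
have g0 := gamma_gt0 i; rewrite /up_prob; case: eqP => [i0|_].
  by rewrite i0 in g0 *; rewrite mul1r divff // gt_eqF // addr_gt0.
case: eqP => _; first by rewrite mulr0.
by rewrite mul1r ler_pdivrMr ?mul1r ?lerD2l ?le_max ?lexx // addr_gt0 ?lt_max ?g0.
Qed.

Lemma up_probS_le i : (1 + g i) * p i.+1 <= 1.
Proof.
have g0 := gamma_gt0 i; rewrite /up_prob /=.
case: eqP => _; first by rewrite mulr0.
rewrite mul1r ler_pdivrMr ?mul1r ?lerD2l ?le_max ?lexx ?orbT //.
by rewrite addr_gt0 // lt_max g0 orbT.
Qed.

(** The two sides have the same denominator. At [i = N] the identity breaks: [p N = 0], while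
    [q N.+1] is a positive junk value. *)
Lemma down_probS i : (i < N)%N -> q i.+1 = g i * p i.
Proof.
by case: i => [|i] iN; rewrite /= /up_prob //= ?(ltn_eqF iN) mul1r.
Qed.

Lemma down_prob_ge0 i : (i <= N)%N -> 0 <= q i.
Proof.
case: i => // i iN; rewrite down_probS //.
by rewrite mulr_ge0 ?ltW ?gamma_gt0 ?up_prob_gt0.
Qed.

Lemma up_down_prob_le i : (i <= N)%N -> p i + q i <= 1.
Proof.
case: i => [|i] iN.
  have := up_prob_le 0; have := gamma_gt0 0; have := up_prob_ge0 iN.
  by rewrite addr0; nra.
rewrite down_probS //.
(* Multiplied by [1 + g i], the sum [p i.+1 + g i * p i] is at most [1 + g i]. *)
have := up_prob_le i; have := up_probS_le i; have := gamma_gt0 i.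
by nra.
Qed.

Lemma hold_prob_ge0 i : (i <= N)%N -> 0 <= r i.
Proof. by move/up_down_prob_le; rewrite /hold_prob; lra. Qed.

Lemma transition_ge0 i j : 0 <= T i j.
Proof.
have iN : (i <= N)%N by rewrite -ltnS.
rewrite mxE; do ![case: ifP => _ //]; first exact: up_prob_ge0.
  exact: down_prob_ge0.
exact: hold_prob_ge0.
Qed.

(* Junk values of [f] are harmless: [f N.+1] and [f 0.-1] occur with weight 0. *)
Lemma transition_sum (i : 'I_N.+1) (f : nat -> R) :
  \sum_j T i j * f j = p i * f i.+1 + r i * f i + q i * f i.-1.
Proof.
(* Each of the three terms becomes a sum over all columns supported at [k]; if [k] is not a state,
   its weight [c] must vanish. *)
have sum_at k (c : R) : (k <= N)%N \/ c = 0 ->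
    \sum_(j < N.+1) (if j == k :> nat then c * f j else 0) = c * f k.
  case=> [kN|->]; last by rewrite mul0r big1 // => j _; rewrite mul0r if_same.
  by rewrite -big_mkcond (big_pred1 (Ordinal (kN : (k < N.+1)%N))).
rewrite -!sum_at -?big_split /=.
- apply: eq_bigr => j _; rewrite mxE -(inj_eq val_inj) /=.
  (* Row 0 is separate: since [0.-1 = 0], its hold and down terms fall in the same column, and
     [q 0 = 0] removes the latter. *)
  case: i => -[|i] /= _.
    have [->|j0] := eqVneq (j : nat) 0%N; first by rewrite /= mul0r; ring.
    by case: ifP => _; ring.
  rewrite eqSS [i == _]eq_sym [i.+1 == _]eq_sym.
  have [jE|j1] := eqVneq (j : nat) i.+2.
    by rewrite jE !gtn_eqF //; ring.
  have [jE|j2] := eqVneq (j : nat) i.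
    by rewrite jE !ltn_eqF //; ring.
  by case: eqP => _; ring.
- by left; have := ltn_ord i; lia.
- by left; have := ltn_ord i; lia.
- have := ltn_ord i; rewrite ltnS leq_eqVlt => /orP[/eqP->|]; last by left.
  by right; exact: up_prob_N.
Qed.

Lemma transition_stochastic : stochastic T.
Proof.
split=> [|i]; first exact: transition_ge0.
under eq_bigr do rewrite -[T _ _]mulr1.
by rewrite (transition_sum i (fun=> 1)) /hold_prob; ring.
Qed.

Lemma transition_monotone : monotone T.
Proof.
move=> i i' m ii'.
have tail k : \sum_(j < N.+1 | (m <= j)%N) T k j =
    p k * (m <= k.+1)%:R + r k * (m <= k)%:R + q k * (m <= k.-1)%:R.
  rewrite -(transition_sum k (fun j => (m <= j)%:R)) big_mkcond /=.
  by apply: eq_bigr => j _; case: ifP; rewrite ?mulr1 ?mulr0.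
have i'N : (i.+1 <= N)%N by rewrite -ii' -ltnS.
have := up_prob_ge0 i'N; have := down_prob_ge0 (ltnW i'N).
have := hold_prob_ge0 i'N; have := up_prob_le i.
have := down_probS i'N.
rewrite !tail ii' /hold_prob /=.
(* If [m <= i], the tail of row [i.+1] is 1; if [m > i.+1], the tail of row [i] is 0. At [m = i.+1]
   the claim is [p i <= 1 - g i * p i], which is [up_prob_le]. *)
case: (ltngtP m i.+1) => [mi|mi|->].
- rewrite ltnS in mi; rewrite mi !leqW //.
  by case: (m <= i.-1)%N; rewrite /=; lra.
- have -> : (m <= i)%N = false by lia.
  have -> : (m <= i.-1)%N = false by lia.
  by case: (m <= i.+2)%N; rewrite /=; lra.
- rewrite leqnSn ltnn; have -> : (i < i.-1)%N = false by lia.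
  by rewrite /=; lra.
Qed.

Lemma transition_irreducible : irreducible T.
Proof.
apply: neighbour_irreducible => // [|i j jE]; first exact: transition_ge0.
have iN : (i < N)%N by rewrite -ltnS -jE.
rewrite !mxE jE !eqxx ltn_eqF // down_probS //.
by rewrite mulr_gt0 ?gamma_gt0 ?up_prob_gt0.
Qed.

Lemma detailed_balance i j : pi 0 i * T i j = pi 0 j * T j i.
Proof.
have up (k l : 'I_N.+1) : l = k.+1 :> nat -> pi 0 k * T k l = pi 0 l * T l k.
  move=> lE; have kN : (k < N)%N by rewrite -ltnS -lE.
  rewrite !mxE lE !eqxx ltn_eqF // down_probS // /gamma -lE !inord_val.
  by field; rewrite gt_eqF.
have [jE|ji] := eqVneq (j : nat) i.+1; first exact: up.
have [iE|ij] := eqVneq (i : nat) j.+1; first by rewrite [RHS]up.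
rewrite !mxE (negPf ji) (negPf ij) [j == i]eq_sym.
by case: eqP => [->//|_]; rewrite !mulr0.
Qed.

(** Harmonicity at [j] says [p j * (x j.+1 - x j) = q j * (x j - x j.-1)]. The first increment
    vanishes because [q 0 = 0], and since [p j > 0] below [N], each zero increment forces the
    next. *)
Lemma harmonic_const (x : nat -> R) :
    (forall j : 'I_N.+1, \sum_i T j i * x i = x j) ->
  forall k, (k <= N)%N -> x k = x 0.
Proof.
move=> xT; have step k : (k < N)%N -> x k.+1 = x k.
  elim: k => [|k IH] kN.
    have : p 0 * x 1 + r 0 * x 0 + q 0 * x 0 = x 0.
      by rewrite -[RHS](xT ord0) transition_sum.
    rewrite /hold_prob => x0.
    by apply: (mulfI (lt0r_neq0 (up_prob_gt0 kN))); lra.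
  have : p k.+1 * x k.+2 + r k.+1 * x k.+1 + q k.+1 * x k = x k.+1.
    by rewrite -[RHS](xT (Ordinal (ltnW kN : (k.+1 < N.+1)%N))) transition_sum.
  rewrite /hold_prob IH ?(ltnW kN) // => x0.
  by apply: (mulfI (lt0r_neq0 (up_prob_gt0 kN))); lra.
by elim=> // k IH kN; rewrite step // IH // ltnW.
Qed.

Lemma invariant_proportional (mu : 'rV[R]_N.+1) :
  mu *m T = mu -> exists c, mu = c *: pi.
Proof.
move=> muT; pose x k := mu 0 (inord k) / pi 0 (inord k).
have xE (i : 'I_N.+1) : mu 0 i = pi 0 i * x i.
  by rewrite /x inord_val mulrC divfK // gt_eqF.
(* Detailed balance turns [pi 0 i * T i j] into [pi 0 j * T j i], and the common factor [pi 0 j]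
   cancels. *)
have xT (j : 'I_N.+1) : \sum_i T j i * x i = x j.
  apply: (mulfI (lt0r_neq0 (pi_gt0 j))); rewrite -xE -[in RHS]muT mxE mulr_sumr.
  by apply: eq_bigr => i _; rewrite xE mulrA -detailed_balance; ring.
exists (x 0%N); apply/rowP=> i.
by rewrite mxE xE (harmonic_const xT) 1?mulrC // -ltnS.
Qed.

Lemma transition_invariant : pi *m T = pi.
Proof.
apply/rowP=> j; rewrite mxE; under eq_bigr do rewrite detailed_balance.
by rewrite -mulr_sumr transition_stochastic.2 mulr1.
Qed.

End BirthDeath.

Theorem theorem2p1 (R : realFieldType) (N : nat) (pi : 'rV[R]_N.+1) :
  (0 < N)%N ->
  distribution pi ->
  (forall i, 0 < pi 0 i) ->
  [/\ stochastic (transition pi),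
      irreducible (transition pi),
      monotone (transition pi)
    & forall mu : 'rV[R]_N.+1, stationary mu (transition pi) <-> mu = pi].
Proof.
move=> N_gt0 pi_distr pi_gt0; split.
- exact: transition_stochastic.
- exact: transition_irreducible.
- exact: transition_monotone.
move=> mu; split=> [[[_ mu1] muT]|->]; last first.
  by split; [|apply: transition_invariant].
have [c muE] := invariant_proportional N_gt0 pi_gt0 muT.
(* Both [mu] and [pi] have total mass 1, which forces [c = 1]. *)
move: mu1; rewrite muE; under eq_bigr do rewrite mxE.
by rewrite -mulr_sumr pi_distr.2 mulr1 => ->; rewrite scale1r.
Qed.
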